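(* Let $f \colon \mathbb{R}^n \to \mathbb{R} \cup \{+\infty\}$ be a lower semi-continuous function and let $\Omega \subset \mathbb{R}^n$ be a closed set such that: (A1) $\mathrm{dom} f \cap \Omega$ is unbounded; (A2) $\partial^\infty f(\infty) \cap (-N_\Omega(\infty)) = \{0\}$; (A3) $f$ is bounded from below on $\Omega$, i.e., $\inf_{x \in \Omega} f(x)$ is finite. For $u \in \mathbb{R}^n$ put $f_u(x) := f(x) - \langle u, x\rangle$, and let $\mathrm{Sol}(u)$ be the set of optimal solutions of the problem of minimizing $f_u$ over $\Omega$. Assume that $0 \notin \partial f(\infty) + N_\Omega(\infty)$. Then there exists a constant $\epsilon > 0$ such that for all $u \in \mathbb{R}^n$ with $\|u\| \le \epsilon$ the following hold: (i) $f_u$ is bounded from below on $\Omega$. (ii) $\mathrm{Sol}(u)$ is nonempty and compact. (iii) The inclusion $\displaystyle\mathop{\mathrm{Lim\,sup}}_{u \to 0} \mathrm{Sol}(u) \subset \mathrm{Sol}(0)$ is valid.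
   Context: $\mathbb{R}^n$ carries the Euclidean norm and scalar product. $\mathrm{dom} f := \{x \mid f(x) < \infty\}$ and $\mathrm{epi} f := \{(x,r) \in \mathbb{R}^n \times \mathbb{R} \mid f(x) \le r\}$. Painlevé–Kuratowski outer limit: $\mathop{\mathrm{Lim\,sup}}_{u \to 0} \mathrm{Sol}(u) := \{y \in \mathbb{R}^n \mid \exists\, u_k \to 0,\ \exists\, y_k \in \mathrm{Sol}(u_k),\ y_k \to y\}$. (Statement (iii) does not depend on the individual $u$.) Regular normal cone: for a set $C \subset \mathbb{R}^N$ and $z \in C$, $\widehat{N}_C(z)$ is the set of $\xi \in \mathbb{R}^N$ with $\langle \xi, z' - z\rangle \le o(\|z' - z\|)$ as $z' \to z$, $z' \in C$. Normal cone at infinity: for an unbounded closed set $\Omega \subset \mathbb{R}^n$, $N_\Omega(\infty)$ is the set of all $\xi \in \mathbb{R}^n$ for which there exist $x_k \in \Omega$ with $\|x_k\| \to \infty$ and $\xi_k \in \widehat{N}_\Omega(x_k)$ with $\xi_k \to \xi$. Subdifferentials at infinity: for $f \colon \mathbb{R}^n \to \mathbb{R} \cup \{+\infty\}$ with $\mathrm{dom} f$ unbounded, let $N_{\mathrm{epi} f}(\infty_I)$ (with $I = \{1,\dots,n\} \subset \{1,\dots,n+1\}$) be the set of all $\zeta \in \mathbb{R}^{n+1}$ for which there exist $(x_k, r_k) \in \mathrm{epi} f$ with $\|x_k\| \to \infty$ and $\zeta_k \in \widehat{N}_{\mathrm{epi} f}(x_k, r_k)$ with $\zeta_k \to \zeta$.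 Then $\partial f(\infty) := \{u \in \mathbb{R}^n \mid (u,-1) \in N_{\mathrm{epi} f}(\infty_I)\}$ and $\partial^\infty f(\infty) := \{u \in \mathbb{R}^n \mid (u,0) \in N_{\mathrm{epi} f}(\infty_I)\}$. *)

(* Defs.v *)
(* R^n is 'rV[R]_n and R^n x R is 'rV[R]_(n + 1). *)
From HB Require Import structures.
From mathcomp Require Import all_boot all_order all_algebra.
From mathcomp Require Import all_classical all_reals all_analysis.
Import Order.TTheory GRing.Theory Num.Theory.
Import numFieldNormedType.Exports.

Set Implicit Arguments.
Unset Strict Implicit.
Unset Printing Implicit Defensive.

Local Open Scope classical_set_scope.
Local Open Scope ring_scope.

Section definitions.
Context {R : realType}.

Definition dot n (x y : 'rV[R]_n) : R := \sum_i x 0 i * y 0 i.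

(* The library norm of 'rV[R]_n is the sup norm.  The library topology of
   'rV[R]_n, used below for limits, closedness, compactness and lower
   semi-continuity, is also the one induced by the Euclidean norm. *)
Definition enorm n (x : 'rV[R]_n) : R := Num.sqrt (dot x x).

Definition unbounded n (A : set 'rV[R]_n) : Prop :=
  ~ [bounded enorm x | x in A].

Definition dom n (f : 'rV[R]_n -> \bar R) : set 'rV[R]_n :=
  [set x | (f x < +oo)%E].

Definition epi n (f : 'rV[R]_n -> \bar R) : set 'rV[R]_(n + 1) :=
  [set z | (f (lsubmx z) <= (rsubmx z 0 0)%:E)%E].

(* The bound <xi, z' - z> <= o(|z' - z|) is spelled out with epsilons. *)
Definition regular_normal_cone N (C : set 'rV[R]_N) (z : 'rV[R]_N)
    : set 'rV[R]_N :=
  [set xi | C z /\ forall e : R, 0 < e -> exists2 d : R, 0 < d &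
     forall z', C z' -> enorm (z' - z) < d ->
       dot xi (z' - z) <= e * enorm (z' - z)].

Definition normal_cone_infty n (Omega : set 'rV[R]_n) : set 'rV[R]_n :=
  [set xi | exists x : nat -> 'rV[R]_n, exists xi_ : nat -> 'rV[R]_n,
    [/\ forall k, Omega (x k),
        enorm (x k) @[k --> \oo] --> +oo,
        forall k, regular_normal_cone Omega (x k) (xi_ k) &
        xi_ k @[k --> \oo] --> xi]].

(* Only the first n coordinates of the base points escape to infinity. *)
Definition normal_cone_inftyI n (C : set 'rV[R]_(n + 1)) :
    set 'rV[R]_(n + 1) :=
  [set zeta | exists z : nat -> 'rV[R]_(n + 1),
    exists zeta_ : nat -> 'rV[R]_(n + 1),
    [/\ forall k, C (z k),
        enorm (lsubmx (z k)) @[k --> \oo] --> +oo,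
        forall k, regular_normal_cone C (z k) (zeta_ k) &
        zeta_ k @[k --> \oo] --> zeta]].

Definition subdiff_infty n (f : 'rV[R]_n -> \bar R) : set 'rV[R]_n :=
  [set u | normal_cone_inftyI (epi f) (row_mx u (const_mx (- 1)))].

Definition singular_subdiff_infty n (f : 'rV[R]_n -> \bar R) :
    set 'rV[R]_n :=
  [set u | normal_cone_inftyI (epi f) (row_mx u (const_mx 0))].

Definition finite_inf n (f : 'rV[R]_n -> \bar R) (A : set 'rV[R]_n) : Prop :=
  ereal_inf (f @` A) \is a fin_num.

Definition tilt n (f : 'rV[R]_n -> \bar R) (u x : 'rV[R]_n) : \bar R :=
  (f x - (dot u x)%:E)%E.

Definition Sol n (f : 'rV[R]_n -> \bar R) (Omega : set 'rV[R]_n)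
    (u : 'rV[R]_n) : set 'rV[R]_n :=
  [set x | Omega x /\ forall y, Omega y -> (tilt f u x <= tilt f u y)%E].

Definition Lim_sup0 n (S : 'rV[R]_n -> set 'rV[R]_n) : set 'rV[R]_n :=
  [set y | exists u : nat -> 'rV[R]_n, exists y_ : nat -> 'rV[R]_n,
    [/\ u k @[k --> \oo] --> (0 : 'rV[R]_n),
        forall k, S (u k) (y_ k) &
        y_ k @[k --> \oo] --> y]].

End definitions.

(* Main.v *)
Require Import Defs.
From HB Require Import structures.
From mathcomp Require Import all_boot all_order all_algebra.
From mathcomp Require Import all_classical all_reals all_analysis.
From mathcomp Require Import ring lra.
Import Order.TTheory GRing.Theory Num.Theory.
Import numFieldNormedType.Exports.

Local Open Scope classical_set_scope.
Local Open Scope ring_scope.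

(* The hypotheses force linear growth: f >= inf_Omega f + k |x| on Omega for
   |x| large, k > 0.  Otherwise there are x0 in Omega with |x0| -> oo and
   f x0 - inf f = o(|x0|).  Minimising f x + c |x - x0|^2 + j |x - w|^2 over
   x and w in Omega, both in the ball of radius |x0| / 2 around x0, with
   c |x0| -> 0 and j large, gives normals (v, -1) to epi f and xi to Omega at
   points escaping to infinity, with v + xi -> 0.  Scaling (v, -1) to norm 1 and
   taking a cluster point gives a vector excluded by A2 (zero last coordinate)
   or by h0 (negative last coordinate).
   Linear growth survives tilts with |u| <= k / 2 and bounds sublevel sets. *)

(** * Euclidean scalar product and norm, and their relation to the sup-norm topology *)

Lemma continuous_subr (R : realType) (V : normedModType R) (a : V) :
  continuous (fun x : V => x - a : V).
Proof.
move=> x.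
exact: (@cvgB _ _ _ (nbhs x) _ id (cst a) _ _ cvg_id (cvg_cst _)).
Qed.

Section euclidean.
Context {R : realType}.

Lemma dotC {n} (x y : 'rV[R]_n) : dot x y = dot y x.
Proof. by apply: eq_bigr => i _; rewrite mulrC. Qed.

Lemma dotDl {n} (x y z : 'rV[R]_n) : dot (x + y) z = dot x z + dot y z.
Proof.
by rewrite /dot -big_split; apply: eq_bigr => i _; rewrite mxE mulrDl.
Qed.

Lemma dotZl {n} (a : R) (x y : 'rV[R]_n) : dot (a *: x) y = a * dot x y.
Proof. by rewrite /dot mulr_sumr; apply: eq_bigr => i _; rewrite mxE mulrA. Qed.

Lemma dot0l {n} (x : 'rV[R]_n) : dot 0 x = 0.
Proof. by rewrite -(scale0r 0) dotZl mul0r. Qed.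

Lemma dotNl {n} (x y : 'rV[R]_n) : dot (- x) y = - dot x y.
Proof. by rewrite -scaleN1r dotZl mulN1r. Qed.

Lemma dotDr {n} (x y z : 'rV[R]_n) : dot x (y + z) = dot x y + dot x z.
Proof. by rewrite dotC dotDl !(dotC _ x). Qed.

Lemma dotNr {n} (x y : 'rV[R]_n) : dot x (- y) = - dot x y.
Proof. by rewrite dotC dotNl dotC. Qed.

Lemma dotZr {n} (a : R) (x y : 'rV[R]_n) : dot x (a *: y) = a * dot x y.
Proof. by rewrite dotC dotZl dotC. Qed.

Lemma dotBB {n} (x y : 'rV[R]_n) :
  dot (x - y) (x - y) = dot x x - 2 * dot x y + dot y y.
Proof. by rewrite !(dotDl, dotDr, dotNl, dotNr) (dotC y x); ring. Qed.

Lemma dot_ge0 {n} (x : 'rV[R]_n) : 0 <= dot x x.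
Proof. by apply: sumr_ge0 => i _; rewrite -expr2 sqr_ge0. Qed.

Lemma dot_eq0 {n} (x : 'rV[R]_n) : dot x x = 0 -> x = 0.
Proof.
move=> /psumr_eq0P x0; apply/rowP => i; rewrite mxE; apply/eqP.
by rewrite -sqrf_eq0 expr2 x0 // => j _; rewrite -expr2 sqr_ge0.
Qed.

Lemma dot_row_mx {n} (x y : 'rV[R]_n) (a b : R) :
  dot (row_mx x (const_mx a : 'rV_1)) (row_mx y (const_mx b)) = dot x y + a * b.
Proof.
rewrite /dot big_split_ord /= big_ord1 !row_mxEr !mxE.
by congr (_ + _); apply: eq_bigr => i _; rewrite !row_mxEl.
Qed.

Lemma enorm_ge0 {n} (x : 'rV[R]_n) : 0 <= enorm x. Proof. exact: sqrtr_ge0. Qed.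

Lemma sqr_enorm {n} (x : 'rV[R]_n) : enorm x ^+ 2 = dot x x.
Proof. by rewrite sqr_sqrtr ?dot_ge0. Qed.

(** Cauchy-Schwarz: the squared length of [dot y y *: x - dot x y *: y] is nonnegative and has the
    factor [dot y y], positive unless [y = 0]. *)
Lemma dot_le_enorm {n} (x y : 'rV[R]_n) : dot x y <= enorm x * enorm y.
Proof.
have [y0|y_neq0] := eqVneq (dot y y) 0.
  by rewrite (dot_eq0 y y0) dotC dot0l mulr_ge0 ?enorm_ge0.
have y_gt0 : 0 < dot y y by rewrite lt0r y_neq0 dot_ge0.
apply: (le_trans (ler_norm _)).
rewrite -(@ler_pXn2r _ 2) ?nnegrE ?mulr_ge0 ?enorm_ge0//.
rewrite real_normK ?num_real// exprMn !sqr_enorm.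
have := dot_ge0 (dot y y *: x - dot x y *: y).
rewrite dotBB !dotZl !dotZr.
rewrite (_ : _ + _ = dot y y * (dot x x * dot y y - dot x y ^+ 2)).
  by rewrite pmulr_rge0// subr_ge0.
ring.
Qed.

Lemma enormD {n} (x y : 'rV[R]_n) : enorm (x + y) <= enorm x + enorm y.
Proof.
rewrite -(@ler_pXn2r _ 2) ?nnegrE ?addr_ge0 ?enorm_ge0// sqrrD !sqr_enorm.
rewrite dotDl !dotDr (dotC y x).
by have := dot_le_enorm x y; lra.
Qed.

Lemma enormN {n} (x : 'rV[R]_n) : enorm (- x) = enorm x.
Proof. by rewrite /enorm dotNl dotNr opprK. Qed.

Lemma enorm_distC {n} (x y : 'rV[R]_n) : enorm (x - y) = enorm (y - x).
Proof. by rewrite -opprB enormN. Qed.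

(** Turns Euclidean bounds into bounds for the sup norm: the square of each coordinate is one
    summand of [dot x x]. *)
Lemma norm_le_enorm {n} (x : 'rV[R]_n) : `|x| <= enorm x.
Proof.
rewrite [leLHS]mx_normrE; apply/bigmax_leP; split; first exact: enorm_ge0.
move=> -[i j] _ /=; rewrite (ord1 i).
rewrite -(@ler_pXn2r _ 2) ?nnegrE ?enorm_ge0// real_normK ?num_real// sqr_enorm.
rewrite /dot (bigD1 j)//= -expr2 lerDl.
by apply: sumr_ge0 => k _; rewrite -expr2 sqr_ge0.
Qed.

Lemma cvg_dot {n} (T : Type) (F : set_system T) {FF : Filter F}
    (g h : T -> 'rV[R]_n) (a b : 'rV[R]_n) :
  g x @[x --> F] --> a -> h x @[x --> F] --> b ->
  dot (g x) (h x) @[x --> F] --> dot a b.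
Proof.
have coord (k : T -> 'rV[R]_n) (c : 'rV[R]_n) i : k x @[x --> F] --> c ->
    (k x 0 i : R) @[x --> F] --> (c 0 i : R).
  move=> kc; exact: (@cvg_comp _ _ _ k (fun x : 'rV[R]_n => x 0 i : R) _ _ _ kc
    (@coord_continuous R _ _ 0 i c)).
move=> ga hb; apply: cvg_big => [|i _]; first exact: add_continuous.
by apply: cvgM; exact: coord.
Qed.

Lemma continuous_dot {n} (T : topologicalType) (g h : T -> 'rV[R]_n) :
  continuous g -> continuous h -> continuous (fun x => dot (g x) (h x)).
Proof. by move=> cg ch x; apply: cvg_dot; [exact: cg|exact: ch]. Qed.

Lemma closed_dot_le {n} (T : topologicalType) (g : T -> 'rV[R]_n) (r : R) :
  continuous g -> closed [set x | dot (g x) (g x) <= r].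
Proof.
move=> cg.
apply: (@preimage_closed _ _ (fun x => dot (g x) (g x)) [set y | y <= r]);
  last exact: closed_le.
by move=> x _; exact: continuous_dot.
Qed.

Lemma closed_dot_ge {n} (T : topologicalType) (g : T -> 'rV[R]_n) (r : R) :
  continuous g -> closed [set x | r <= dot (g x) (g x)].
Proof.
move=> cg.
apply: (@preimage_closed _ _ (fun x => dot (g x) (g x)) [set y | r <= y]);
  last exact: closed_ge.
by move=> x _; exact: continuous_dot.
Qed.

Lemma bounded_enorm {n} (A : set 'rV[R]_n) (M : R) :
  (forall x, A x -> enorm x <= M) -> bounded_set A.
Proof.
move=> AM; exists M; split; first exact: num_real.
move=> N MN x /AM xM /=.
by rewrite (le_trans (norm_le_enorm x))// (le_trans xM)// ltW.
Qed.

(** Stated with squares so that closedness follows from continuity of [dot]. *)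
Lemma compact_eball {n} (x0 : 'rV[R]_n) (r : R) : 0 <= r ->
  compact [set x | dot (x - x0) (x - x0) <= r ^+ 2].
Proof.
move=> r0; apply: bounded_closed_compact.
  apply: (@bounded_enorm _ _ (r + enorm x0)) => x /=.
  rewrite -sqr_enorm ler_pXn2r ?nnegrE ?enorm_ge0// => xr.
  by rewrite -[x](subrK x0) (le_trans (enormD _ _))// lerD2r.
apply: (closed_dot_le _ (fun x : 'rV[R]_n => x - x0)).
exact: continuous_subr.
Qed.

End euclidean.

(** * Lower semicontinuity: sums, sublevel sets, minima on compact sets *)

Section lower_semicontinuity.
Context {R : realType}.

Lemma lscD_cont (T : topologicalType) (f : T -> \bar R) (h : T -> R) :
  (forall x, f x != -oo%E) -> lower_semicontinuous f -> continuous h ->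
  lower_semicontinuous (fun x => f x + (h x)%:E)%E.
Proof.
move=> fN lf ch x a ax.
(* [b] takes half of the slack [f x + h x - a] and leaves the other half to [h]; if [f x] is
   infinite, any [b] above [a - h x] will do. *)
have [b [bf ab]] : exists b : R, (b%:E < f x)%E /\ a < b + h x.
  case: (f x) (fN x) ax => [c| |]// _.
    rewrite -EFinD lte_fin => ac; exists (c - (c + h x - a) / 2).
    by rewrite lte_fin; split; lra.
  by move=> _; exists (a - h x + 1); rewrite ltry; split => //; lra.
have [V xV Vb] := lf _ _ bf.
exists (V `&` [set y | a - b < h y]).
  by apply: filterI => //; apply: (cvgr_gt (h x) (ch x)); lra.
move=> y [/Vb fy /= hy].
rewrite (@le_lt_trans _ _ (b%:E + (a - b)%:E)%E)//.
  by rewrite -EFinD lee_fin; lra.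
by apply: lteD; rewrite // lte_fin.
Qed.

Lemma lsc_comp (S T : topologicalType) (f : T -> \bar R) (g : S -> T) :
  lower_semicontinuous f -> continuous g -> lower_semicontinuous (f \o g).
Proof.
move=> lf cg x a /lf[V gxV Va]; exists (g @^-1` V); first exact: cg.
by move=> y /Va.
Qed.

Lemma lsc_closed_le (T : topologicalType) (f : T -> \bar R) (a : \bar R) :
  lower_semicontinuous f -> closed [set x | (f x <= a)%E].
Proof.
move=> lf x clx /=; rewrite leNgt; apply/negP => afx.
(* Lower semicontinuity is tested on real levels, so a real [c] is inserted between the two extended
   values. *)
have [c [cfx ac]] : exists c : R, (c%:E < f x)%E /\ (a <= c%:E)%E.
  case: a afx {clx} => [r rf|oof|]; [by exists r|by rewrite ltNge leey in oof|].
  case: (f x) => [r _|_|]; last by rewrite ltxx.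
    2: by exists 0; split; [exact: ltry|exact: leNye].
  by exists (r - 1); split; [|exact: leNye]; rewrite lte_fin ltrBlDr ltrDl.
have [V xV Vc] := lf _ _ cfx.
have [y [/= fya Vy]] := clx V xV.
by have := Vc y Vy; rewrite ltNge (le_trans fya ac).
Qed.

(** The sublevel sets at the values of [f] on [K] form a chain of nonempty sets, hence a filter
    base; a cluster point in [K] belongs to all of them, as they are closed. *)
Lemma lsc_compact_min (T : topologicalType) (K : set T) (f : T -> \bar R) :
  lower_semicontinuous f -> compact K -> K !=set0 ->
  exists2 x, K x & forall y, K y -> (f x <= f y)%E.
Proof.
move=> lf cK [z Kz].
pose F := filter_from [set x | K x] (fun x => K `&` [set y | (f y <= f x)%E]).
have FF : ProperFilter F.
  apply: filter_from_proper; last by move=> x Kx; exists x; split => /=.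
  apply: filter_from_filter; first by exists z.
  move=> x y Kx Ky; have [xy|/ltW yx] := leP (f x) (f y).
    exists x => // w [/= Kw wx]; split; split => //.
    exact: le_trans wx xy.
  exists y => // w [/= Kw wx]; split; split => //.
  exact: le_trans wx yx.
have [|x [Kx clx]] := cK F FF; first by exists z => // w [].
exists x => // y Ky.
apply: (lsc_closed_le _ f (f y) lf) => B xB.
by apply: clx => //; exists y => // w [].
Qed.

(** Takes the place of extracting convergent subsequences in the compactness arguments below. *)
Lemma cluster_closed (T : topologicalType) (u : nat -> T) (A : set T) (p : T) :
  closed A -> (\forall k \near \oo, A (u k)) -> cluster (u @ \oo) p -> A p.
Proof. by move=> cA Au clp; apply: cA => B pB; apply: clp. Qed.

End lower_semicontinuity.

(** * Regular normals: quadratic criterion, scaling, penalised minima *)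

Section normals.
Context {R : realType}.

(** A quadratic remainder is [o] of the distance. *)
Lemma regular_normal_cone_quad {N} (C : set 'rV[R]_N) (z xi : 'rV[R]_N)
    (K d : R) : 0 <= K -> 0 < d -> C z ->
  (forall z', C z' -> enorm (z' - z) < d ->
     dot xi (z' - z) <= K * dot (z' - z) (z' - z)) ->
  regular_normal_cone C z xi.
Proof.
move=> K0 d0 Cz quad; split => // e e0.
have K1 : 0 < K + 1 by lra.
(* Below this radius [K] times the distance is at most [e]; the added 1 keeps the quotient
   meaningful for [K = 0]. *)
exists (Num.min d (e / (K + 1))); first by rewrite lt_min d0 divr_gt0.
move=> z' Cz'; rewrite lt_min ltr_pdivlMr// => /andP[zd ze].
apply: (le_trans (quad z' Cz' zd)); rewrite -sqr_enorm.
by have := enorm_ge0 (z' - z); nra.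
Qed.

Lemma regular_normal_coneZ {N} (C : set 'rV[R]_N) (z xi : 'rV[R]_N) (s : R) :
  0 < s -> regular_normal_cone C z xi -> regular_normal_cone C z (s *: xi).
Proof.
move=> s0 [Cz xin]; split => // e e0.
have [d d0 xid] := xin (e / s) (divr_gt0 e0 s0).
exists d => // z' Cz' z'd; rewrite dotZl mulrC -ler_pdivlMr//.
by rewrite mulrAC; exact: xid.
Qed.

Lemma normal_cone_inftyIZ {n} (C : set 'rV[R]_(n + 1)) (zeta : 'rV[R]_(n + 1))
    (s : R) :
  0 < s -> normal_cone_inftyI C zeta -> normal_cone_inftyI C (s *: zeta).
Proof.
move=> s0 [z [xi [Cz zoo xin xi_zeta]]].
exists z, (fun k => s *: xi k); split => //; last exact: cvgZl_tmp.
by move=> k; exact: regular_normal_coneZ.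
Qed.

Lemma normal_cone_inftyZ {n} (C : set 'rV[R]_n) (zeta : 'rV[R]_n) (s : R) :
  0 < s -> normal_cone_infty C zeta -> normal_cone_infty C (s *: zeta).
Proof.
move=> s0 [z [xi [Cz zoo xin xi_zeta]]].
exists z, (fun k => s *: xi k); split => //; last exact: cvgZl_tmp.
by move=> k; exact: regular_normal_coneZ.
Qed.

(** Freezing [w] and then [x] gives one first-order condition each: the normals come from minus the
    partial gradients of the penalty, and the remainders are quadratic with factors [c + j] and [j].
    The [j] terms of the two normals are opposite. *)
Lemma penalized_min_normals {n} (f : 'rV[R]_n -> \bar R) (Omega : set 'rV[R]_n)
    (x0 x w : 'rV[R]_n) (a c j d : R) :
  0 <= c -> 0 <= j -> 0 < d -> f x = a%:E -> Omega w ->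
  (forall x' w', Omega w' -> enorm (x' - x) < d -> enorm (w' - w) < d ->
    (f x + (c * dot (x - x0) (x - x0) + j * dot (x - w) (x - w))%:E <=
     f x' +
       (c * dot (x' - x0) (x' - x0) + j * dot (x' - w') (x' - w'))%:E)%E) ->
  regular_normal_cone (epi f) (row_mx x (const_mx a))
    (row_mx (- (2 * c) *: (x - x0) - (2 * j) *: (x - w)) (const_mx (- 1))) /\
  regular_normal_cone Omega w ((2 * j) *: (x - w)).
Proof.
move=> c0 j0 d0 fx Ow xw_min; split.
  apply: (@regular_normal_cone_quad _ _ _ _ (c + j) d) => //.
  - by rewrite addr_ge0.
  - by rewrite /epi /= row_mxKl row_mxKr mxE fx.
  move=> z'; rewrite /epi /=; set x' := lsubmx z'; set r := rsubmx z' 0 0.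
  have -> : z' = row_mx x' (const_mx r).
    rewrite -[LHS]hsubmxK; congr row_mx; apply/matrixP => i k.
    by rewrite [RHS]mxE !ord1.
  have -> : row_mx x' (const_mx r) - row_mx x (const_mx a) =
      row_mx (x' - x) (const_mx (r - a)) :> 'rV[R]_(n + 1).
    rewrite opp_row_mx add_row_mx; congr row_mx.
    by apply/matrixP => i k; rewrite !mxE.
  rewrite !dot_row_mx => fx'r z'd.
  have x'd : enorm (x' - x) < d.
    apply: le_lt_trans z'd; rewrite ler_sqrt ?dot_ge0// dot_row_mx lerDl.
    by rewrite -expr2 sqr_ge0.
  have := xw_min x' w Ow x'd; rewrite subrr /enorm.
  rewrite {1}dot0l sqrtr0.
  move=> /(_ d0); rewrite fx => min_x.
  have {min_x} := le_trans min_x (leeD2r _ fx'r).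
  rewrite -!EFinD lee_fin.
  have -> : x' - x0 = (x' - x) + (x - x0) by rewrite addrA subrK.
  have -> : x' - w = (x' - x) + (x - w) by rewrite addrA subrK.
  move: (x' - x) (x - x0) (x - w) => D A B.
  rewrite !(dotDl, dotDr) !(dotNl, dotZl) (dotC D A) (dotC D B).
  (* The vertical part of the squared distance only enlarges the right-hand side. *)
  have rr : 0 <= (c + j) * ((r - a) * (r - a)).
    by rewrite mulr_ge0 ?addr_ge0// -expr2 sqr_ge0.
  by move: (dot D D) (dot A D) (dot B D) rr => ? ? ?; lra.
apply: (@regular_normal_cone_quad _ _ _ _ j d) => // w' Ow' w'd.
have := xw_min x w' Ow'; rewrite subrr /enorm.
rewrite {1}dot0l sqrtr0.
move=> /(_ d0 w'd); rewrite fx -!EFinD lee_fin.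
have -> : x - w' = (x - w) - (w' - w) by rewrite opprB addrA subrK.
move: (w' - w) (x - w) => D B.
by rewrite (dotBB B D) dotZl; move: (dot D D) (dot B D) => ? ?; lra.
Qed.

End normals.

(** * Approximate critical points by a decoupled penalised minimisation *)

Lemma fin_num_between {R : realType} (x : \bar R) (a : R) :
  x != -oo%E -> (x <= a%:E)%E -> exists2 b, x = b%:E & b <= a.
Proof. by case: x => [b| |]// _; rewrite ?lee_fin => ba; exists b. Qed.

Section approximate_critical_points.
Context {R : realType} {n : nat}.
Variables (f : 'rV[R]_n -> \bar R) (Omega : set 'rV[R]_n).
Hypotheses (f_proper : forall x, f x != -oo%E) (f_lsc : lower_semicontinuous f).
Hypothesis Omega_closed : closed Omega.

(** For a pair [p = (x, w)] the first term ties [x] to [x0] and the second ties [x] to [w], so that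
    [f] and the constraint act on separate variables. *)
Let penalty (x0 : 'rV[R]_n) (c j : R) (p : 'rV[R]_n * 'rV[R]_n) : R :=
  c * dot (p.1 - x0) (p.1 - x0) + j * dot (p.1 - p.2) (p.1 - p.2).

Let fst_subr_continuous (x0 : 'rV[R]_n) :
  continuous (fun p : 'rV[R]_n * 'rV[R]_n => p.1 - x0 : 'rV[R]_n).
Proof.
move=> p.
exact: (@cvgB _ _ _ (nbhs p) _ fst (cst x0) _ _ cvg_fst (cvg_cst _)).
Qed.

Let snd_subr_continuous (x0 : 'rV[R]_n) :
  continuous (fun p : 'rV[R]_n * 'rV[R]_n => p.2 - x0 : 'rV[R]_n).
Proof.
move=> p.
exact: (@cvgB _ _ _ (nbhs p) _ snd (cst x0) _ _ cvg_snd (cvg_cst _)).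
Qed.

Let fst_sub_snd_continuous :
  continuous (fun p : 'rV[R]_n * 'rV[R]_n => p.1 - p.2 : 'rV[R]_n).
Proof.
move=> p.
exact: (@cvgB _ _ _ (nbhs p) _ fst snd _ _ cvg_fst cvg_snd).
Qed.

Let lsc_penalty x0 c j :
  lower_semicontinuous (fun p => (f p.1 + (penalty x0 c j p)%:E)%E).
Proof.
apply: (lscD_cont _ (fun p : 'rV[R]_n * 'rV[R]_n => f p.1)) => //.
  by apply: (lsc_comp _ _ f fst) => // p; exact: cvg_fst.
move=> p; apply: cvgD; apply: cvgM; (try exact: cvg_cst).
  exact: (continuous_dot _ _ _
    (fst_subr_continuous x0) (fst_subr_continuous x0)).
exact: (continuous_dot _ _ _ fst_sub_snd_continuous fst_sub_snd_continuous).
Qed.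

(** The strict bound keeps minimisers off the sphere: a limit point has [x = w] in [Omega], where
    [f >= m], so [c * |x - x0|^2 <= a0 - m < c * r^2]. For some weight [j] the minimiser is
    therefore interior. *)
Lemma approx_critical (m a0 c r : R) (x0 : 'rV[R]_n) :
  (forall x, Omega x -> (m%:E <= f x)%E) -> Omega x0 -> f x0 = a0%:E ->
  0 < c -> 0 < r -> a0 < m + c * r ^+ 2 ->
  exists x w v xi : 'rV[R]_n, exists a : R,
    [/\ enorm (x - x0) < r /\ enorm (w - x0) < r,
        regular_normal_cone (epi f) (row_mx x (const_mx a))
          (row_mx v (const_mx (- 1))),
        regular_normal_cone Omega w xi &
        v + xi = - (2 * c) *: (x - x0)].
Proof.
move=> fm Ox0 fx0 c0 r0 a0_lt.
pose B : set 'rV[R]_n := [set x | dot (x - x0) (x - x0) <= r ^+ 2].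
have cB : compact B by apply: compact_eball; exact: ltW.
have Bx0 : B x0 by rewrite /B /= subrr dot0l sqr_ge0.
(* [m] bounds [f] on [Omega] only, while [x] ranges over all of [B]. *)
have [b fb] : exists b : R, forall x, B x -> (b%:E <= f x)%E.
  have [|xb Bxb xb_min] := lsc_compact_min _ B f f_lsc cB; first by exists x0.
  have := xb_min x0 Bx0; rewrite fx0.
  move=> /(fin_num_between _ _ (f_proper _))[b fxb _].
  by exists b => x /xb_min; rewrite fxb.
pose P := B `*` (B `&` Omega).
have cP : compact P by apply: compact_setX => //; exact: compact_closedI.
have P00 : P (x0, x0) by [].
have /choice[p p_min] : forall k : nat, exists p : 'rV[R]_n * 'rV[R]_n, P p /\
    forall q, P q -> (f p.1 + (penalty x0 c k%:R p)%:E <=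
                      f q.1 + (penalty x0 c k%:R q)%:E)%E.
  move=> k.
  have [|q Pq qmin] := lsc_compact_min _ P _ (lsc_penalty x0 c k%:R) cP.
    by exists (x0, x0).
  by exists q.
(* Comparison with the feasible pair [(x0, x0)], whose penalty is zero. *)
have p_le k : exists2 a, f (p k).1 = a%:E & a + penalty x0 c k%:R (p k) <= a0.
  have := (p_min k).2 _ P00.
  rewrite {2}/penalty /= !subrr dot0l !mulr0 addr0 adde0 fx0.
  case: (f (p k).1) (f_proper (p k).1) => [a| |]// _.
  by rewrite -EFinD lee_fin => ?; exists a.
have pP k : P (p k) := (p_min k).1.
have [|q [[Bq1 [Bq2 Oq2]] clq]] := cP (p @ \oo) _.
  exact: (@nearW _ \oo).
(* Along the sequence [k * |x - w|^2 <= a0 - b], so the gap vanishes at the cluster point. *)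
have q12 : q.1 = q.2.
  apply/subr0_eq/dot_eq0/le_anti; rewrite dot_ge0 andbT.
  apply/ler_addgt0Pl => e e0; rewrite addr0.
  apply: (cluster_closed _ p _ q
    (closed_dot_le _ _ e fst_sub_snd_continuous) _ clq).
  near=> k => /=.
  have [a fa ap] := p_le k.
  have := fb _ (pP k).1; rewrite fa lee_fin => ba.
  have k_ge : (a0 - b) / e <= k%:R by near: k; exact: nbhs_infty_ger.
  have k_gt : 0 < k%:R :> R by near: k; exact: nbhs_infty_gtr.
  rewrite -(ler_pM2l k_gt); rewrite ler_pdivrMr// in k_ge.
  apply: le_trans k_ge; move: ap; rewrite /penalty.
  have := mulr_ge0 (ltW c0) (dot_ge0 ((p k).1 - x0)).
  lra.
(* Weight 0 leaves the [c] term alone, an objective independent of [k] whose closed sublevel set at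
   [a0] contains every [p k]. *)
have q_int : dot (q.1 - x0) (q.1 - x0) < r ^+ 2.
  have : (f q.1 + (penalty x0 c 0 q)%:E <= a0%:E)%E.
    apply: (cluster_closed _ p _ q
      (lsc_closed_le _ _ a0%:E (lsc_penalty x0 c 0)) _ clq).
    apply: nearW => k /=; have [a -> ap] := p_le k.
    rewrite -EFinD lee_fin (le_trans _ ap)// lerD2l /penalty mul0r addr0 lerDl.
    by rewrite mulr_ge0// dot_ge0.
  have := fm _ Oq2; rewrite -q12 /penalty mul0r addr0.
  case: (f q.1) => [a| |]//; rewrite -EFinD !lee_fin => ma aa0.
  by rewrite -(ltr_pM2l c0); lra.
(* Otherwise every [p k] has a component outside the open ball, a closed condition inherited by [q],
   against [q_int] and [q12]. *)
have [k [pk1 pk2]] : exists k, dot ((p k).1 - x0) ((p k).1 - x0) < r ^+ 2 /\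
    dot ((p k).2 - x0) ((p k).2 - x0) < r ^+ 2.
  apply: contrapT => /forallNP pk.
  have : ([set x | r ^+ 2 <= dot (x.1 - x0) (x.1 - x0)] `|`
          [set x | r ^+ 2 <= dot (x.2 - x0) (x.2 - x0)]) q.
    apply: (cluster_closed _ p _ q _ _ clq).
      apply: closedU; apply: closed_dot_ge.
        exact: fst_subr_continuous.
      exact: snd_subr_continuous.
    apply: nearW => k /=; have /not_andP[|] := pk k.
      by move=> /negP; rewrite -leNgt; left.
    by move=> /negP; rewrite -leNgt; right.
  by rewrite /setU /= -q12 leNgt q_int; case.
have [a fa _] := p_le k.
have enorm_lt (y : 'rV[R]_n) : (dot y y < r ^+ 2) = (enorm y < r).
  by rewrite -sqr_enorm ltr_pXn2r ?nnegrE ?enorm_ge0// ltW.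
rewrite !enorm_lt in pk1 pk2.
(* The slack up to the sphere: perturbations by less than [d] stay in [B]. *)
pose d := Num.min (r - enorm ((p k).1 - x0)) (r - enorm ((p k).2 - x0)).
have d0 : 0 < d by rewrite lt_min !subr_gt0 pk1.
have inB (y z : 'rV[R]_n) : enorm (y - z) < r - enorm (z - x0) -> B y.
  move=> yz; rewrite /B /= ltW// enorm_lt.
  have -> : y - x0 = (y - z) + (z - x0) by rewrite addrA subrK.
  by rewrite (le_lt_trans (enormD _ _))// -ltrBrDr.
have [|epiN OmN] := penalized_min_normals f Omega x0 (p k).1 (p k).2 a c k%:R d
  (ltW c0) (ler0n _ _) d0 fa (pP k).2.2.
  move=> x' w' Ow'; rewrite !lt_min => /andP[x'd _] /andP[_ w'd].
  apply: ((p_min k).2 (x', w')); split; first exact: inB x'd.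
  by split => //=; exact: inB w'd.
exists (p k).1, (p k).2; do 2 eexists; exists a.
split; [by []|exact: epiN|exact: OmN|by rewrite subrK].
Unshelve. all: by end_near. Qed.

End approximate_critical_points.

(** * Linear growth of [f] on [Omega] from the conditions at infinity *)

Section coercivity.
Context {R : realType} {n : nat}.

(** Diagonal choice with tolerance [1 / (k + 1)] and escape radius [k]; it lets cluster points of
    normals count as normals at infinity. *)
Lemma normal_cone_inftyIP (C : set 'rV[R]_(n + 1)) (zeta : 'rV[R]_(n + 1)) :
  (forall e M : R, 0 < e -> exists z xi, [/\ M <= enorm (lsubmx z),
     regular_normal_cone C z xi & `|zeta - xi| < e]) ->
  normal_cone_inftyI C zeta.
Proof.
move=> approx.
have /choice[p pP] : forall k : nat, exists p : 'rV[R]_(n + 1) * 'rV[R]_(n + 1),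
    [/\ k%:R <= enorm (lsubmx p.1), regular_normal_cone C p.1 p.2 &
        `|zeta - p.2| < k.+1%:R^-1].
  move=> k; have [|z [xi [? ? ?]]] := approx k.+1%:R^-1 k%:R.
    by rewrite invr_gt0.
  by exists (z, xi).
exists (fun k => (p k).1), (fun k => (p k).2); split.
- by move=> k; have [_ []] := pP k.
- apply/cvgryPge => A; near=> k; have [+ _ _] := pP k; apply: le_trans.
  by near: k; exact: nbhs_infty_ger.
- by move=> k; have [] := pP k.
- apply/cvgrPdist_lt => e e0; near=> k; have [_ _ +] := pP k.
  move=> /lt_trans; apply; near: k; exact: near_infty_natSinv_lt (PosNum e0).
Unshelve. all: by end_near. Qed.

Lemma normal_cone_inftyP (C : set 'rV[R]_n) (zeta : 'rV[R]_n) :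
  (forall e M : R, 0 < e -> exists z xi, [/\ M <= enorm z,
     regular_normal_cone C z xi & `|zeta - xi| < e]) ->
  normal_cone_infty C zeta.
Proof.
move=> approx.
have /choice[p pP] : forall k : nat, exists p : 'rV[R]_n * 'rV[R]_n,
    [/\ k%:R <= enorm p.1, regular_normal_cone C p.1 p.2 &
        `|zeta - p.2| < k.+1%:R^-1].
  move=> k; have [|z [xi [? ? ?]]] := approx k.+1%:R^-1 k%:R.
    by rewrite invr_gt0.
  by exists (z, xi).
exists (fun k => (p k).1), (fun k => (p k).2); split.
- by move=> k; have [_ []] := pP k.
- apply/cvgryPge => A; near=> k; have [+ _ _] := pP k; apply: le_trans.
  by near: k; exact: nbhs_infty_ger.
- by move=> k; have [] := pP k.
- apply/cvgrPdist_lt => e e0; near=> k; have [_ _ +] := pP k.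
  move=> /lt_trans; apply; near: k; exact: near_infty_natSinv_lt (PosNum e0).
Unshelve. all: by end_near. Qed.

Lemma norm_lsubmx_le (z : 'rV[R]_(n + 1)) : `|lsubmx z| <= `|z|.
Proof.
rewrite [leLHS]mx_normrE; apply/bigmax_leP; split => // -[i j] _ /=.
rewrite mxE [leRHS]mx_normrE.
exact: (le_bigmax _ (fun ij => `|z ij.1 ij.2|) (i, lshift 1 j)).
Qed.

Lemma norm_row_mx_ge (v : 'rV[R]_n) (a : R) :
  `|a| <= `|row_mx v (const_mx a : 'rV_1)|.
Proof.
rewrite [leRHS]mx_normrE.
rewrite (le_trans _ (le_bigmax _ _ (0, rshift n 0)))//=.
by rewrite row_mxEr mxE.
Qed.

Variables (f : 'rV[R]_n -> \bar R) (Omega : set 'rV[R]_n).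
Hypotheses (f_proper : forall x, f x != -oo%E) (f_lsc : lower_semicontinuous f).
Hypothesis Omega_closed : closed Omega.

Lemma normalized_critical (m s a0 : R) (x0 : 'rV[R]_n) :
  (forall x, Omega x -> (m%:E <= f x)%E) -> Omega x0 -> f x0 = a0%:E ->
  0 < s -> s <= enorm x0 -> a0 < m + s^-1 * enorm x0 ->
  exists (z zeta : 'rV[R]_(n + 1)) (w xi : 'rV[R]_n),
    [/\ s / 2 <= enorm (lsubmx z) /\ s / 2 <= enorm w,
        regular_normal_cone (epi f) z zeta, regular_normal_cone Omega w xi,
        `|zeta| = 1 /\ zeta 0 (rshift n 0) <= 0 &
        `|lsubmx zeta + xi| <= 4 / s].
Proof.
move=> fm Ox0 fx0 s0 sx0 a0_lt.
have N0 : 0 < enorm x0 by exact: lt_le_trans sx0.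
have s_neq0 : s != 0 by rewrite gt_eqF.
have N_neq0 : enorm x0 != 0 by rewrite gt_eqF.
(* Half of [|x0|] as radius stays far from the origin; [c] makes [c * r ^+ 2] equal to the allowed
   excess [s^-1 * enorm x0], whence [2 * c * r = 4 / s]. *)
pose r := enorm x0 / 2; pose c := 4 / (s * enorm x0).
have r0 : 0 < r by rewrite divr_gt0.
have c0 : 0 < c by rewrite divr_gt0// mulr_gt0.
have cr2 : c * r ^+ 2 = s^-1 * enorm x0 by rewrite /c /r; field; rewrite s_neq0.
have [|x [w [v [xi [a [[xr wr] vN xiN vxi]]]]]] :=
  approx_critical f Omega f_proper f_lsc Omega_closed m a0 c r x0
    fm Ox0 fx0 c0 r0.
  by rewrite cr2.
have far (y : 'rV[R]_n) : enorm (y - x0) < r -> s / 2 <= enorm y.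
  move=> yr; have := enormD y (x0 - y); rewrite addrC subrK enorm_distC.
  by move: yr; rewrite /r; lra.
set zeta := row_mx v (const_mx (-1) : 'rV_1).
(* The last entry -1 makes the norm at least 1, so normalising can only shrink the sum of the
   normals. *)
have zeta1 : 1 <= `|zeta| by rewrite -[leLHS]normrN1 norm_row_mx_ge.
have zeta0 : 0 < `|zeta| by exact: lt_le_trans zeta1.
exists (row_mx x (const_mx a)), (`|zeta|^-1 *: zeta), w, (`|zeta|^-1 *: xi).
rewrite row_mxKl; split.
- by split; exact: far.
- by apply: regular_normal_coneZ => //; rewrite invr_gt0.
- by apply: regular_normal_coneZ => //; rewrite invr_gt0.
- rewrite normrZ normfV normr_id mulVf ?gt_eqF//; split => //.
  by rewrite mxE row_mxEr mxE mulrN1 oppr_le0 invr_ge0 ltW.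
- rewrite linearZ/= row_mxKl -scalerDr vxi normrZ normfV normr_id.
  apply: (@le_trans _ _ (enorm (- (2 * c) *: (x - x0)))).
    apply: le_trans (norm_le_enorm _).
    by rewrite ler_piMl// invf_le1.
  rewrite -(@ler_pXn2r _ 2) ?nnegrE ?enorm_ge0 ?divr_ge0 ?(ltW s0)//.
  rewrite sqr_enorm dotZl dotZr -sqr_enorm.
  have -> : 4 / s = 2 * c * r by rewrite /c /r; field; rewrite ?s_neq0 ?N_neq0.
  have : enorm (x - x0) ^+ 2 <= r ^+ 2.
    by rewrite ler_pXn2r ?nnegrE ?enorm_ge0 ?ltW.
  have := mulr_ge0 (ltW c0) (ltW c0).
  nra.
Qed.

Hypothesis A2 : singular_subdiff_infty f `&`
  [set - v | v in normal_cone_infty Omega] = [set 0].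
Hypothesis h0 :
  ~ [set v + w | v in subdiff_infty f & w in normal_cone_infty Omega]
      (0 : 'rV[R]_n).

(** Let [- s] be the last coordinate. For [s = 0] hypothesis [A2] applies; for [s > 0] division by
    [s] gives a point of [subdiff_infty f] whose opposite is normal to [Omega] at infinity, which
    [h0] forbids. *)
Lemma no_normals_at_infinity (zeta : 'rV[R]_(n + 1)) :
  zeta 0 (rshift n 0) <= 0 -> normal_cone_inftyI (epi f) zeta ->
  normal_cone_infty Omega (- lsubmx zeta) -> zeta = 0.
Proof.
set v := lsubmx zeta; set s := - zeta 0 (rshift n 0).
have -> : zeta = row_mx v (const_mx (- s)).
  rewrite -[LHS]hsubmxK; congr row_mx; apply/matrixP => i k.
  by rewrite !mxE !ord1 opprK.
rewrite row_mxEr mxE oppr_le0 => s_ge0 zetaN vN.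
have [s0|s0] := eqVneq s 0.
  have : [set 0] v.
    rewrite -A2; split; last by exists (- v); rewrite ?opprK.
    by move: zetaN; rewrite s0 oppr0.
  by move=> /= ->; rewrite s0 oppr0; exact: row_mx0.
exfalso; apply: h0; have sV0 : 0 < s^-1 by rewrite invr_gt0 lt0r s0.
exists (s^-1 *: v); last first.
  exists (s^-1 *: - v); first exact: normal_cone_inftyZ.
  by rewrite -scalerDr subrr scaler0.
have := normal_cone_inftyIZ _ _ _ sV0 zetaN; rewrite scale_row_mx.
rewrite /subdiff_infty /=; congr (normal_cone_inftyI _ (row_mx _ _)).
by apply/matrixP => i k; rewrite !mxE mulrN mulVf.
Qed.

Lemma linear_growth (m : R) : (forall x, Omega x -> (m%:E <= f x)%E) ->
  exists2 c : R, 0 < c & exists rho : R, forall x, Omega x -> rho <= enorm x ->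
    ((m + c * enorm x)%:E <= f x)%E.
Proof.
move=> fm; apply: contrapT => no_growth.
(* The negation is used with rate [s^-1] and radius [s]: large [s] means slow growth far away. *)
have bad (s : R) : 0 < s -> exists x0 a0, [/\ Omega x0, f x0 = a0%:E,
    s <= enorm x0 & a0 < m + s^-1 * enorm x0].
  move=> s0; apply: contrapT => nbad; apply: no_growth.
  exists s^-1; first by rewrite invr_gt0.
  exists s => x Ox sx; rewrite leNgt; apply/negP => fx; apply: nbad.
  have [a fxa _] := fin_num_between _ _ (f_proper x) (ltW fx).
  by exists x, a; split => //; move: fx; rewrite fxa lte_fin.
pose D := ('rV[R]_(n + 1) * 'rV[R]_(n + 1) * 'rV[R]_n * 'rV[R]_n)%type.
have /choice[p pP] : forall k : nat, exists p : D,
    [/\ k%:R <= enorm (lsubmx p.1.1.1) /\ k%:R <= enorm p.1.2,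
        regular_normal_cone (epi f) p.1.1.1 p.1.1.2,
        regular_normal_cone Omega p.1.2 p.2,
        `|p.1.1.2| = 1 /\ p.1.1.2 0 (rshift n 0) <= 0 &
        `|lsubmx p.1.1.2 + p.2| <= k.+1%:R^-1].
  (* [s = 4 * (k + 1)] turns the error [4 / s] into [1 / (k + 1)] and makes the radius [s / 2] at
     least [k]. *)
  move=> k; have s0 : 0 < 4 * k.+1%:R :> R by rewrite mulr_gt0.
  have [x0 [a0 [Ox0 fx0 sx0 a0_lt]]] := bad _ s0.
  have [z [zeta [w [xi [[zk wk] zN wN zeta1 e]]]]] :=
    normalized_critical m _ a0 x0 fm Ox0 fx0 s0 sx0 a0_lt.
  have k_le : k%:R <= 4 * k.+1%:R / 2 :> R.
    by have := ler0n R k; rewrite -natr1; lra.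
  exists (z, zeta, w, xi); split => //=.
  - by split; [exact: le_trans zk|exact: le_trans wk].
  - by move: e; rewrite invfM mulrA divff// mul1r.
pose u k := (p k).1.1.2.
(* The normalised epigraph normals live on the compact lower half of the unit sphere, which keeps a
   cluster point nonzero. *)
pose S := [set z : 'rV[R]_(n + 1) | `|z| = 1] `&`
  [set z | z 0 (rshift n 0) <= 0].
have cS : compact S.
  apply: bounded_closed_compact.
    by exists 1; split => // M M1 x [/= -> _]; rewrite ltW.
  apply: closedI.
    apply: (@preimage_closed _ _ (fun z : 'rV[R]_(n + 1) => `|z|) [set 1]).
      by move=> x _; exact: norm_continuous.
    exact: closed_eq.
  apply: (@preimage_closed _ _ (fun z : 'rV[R]_(n + 1) => z 0 (rshift n 0))
    [set y | y <= 0]).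
    by move=> x _; exact: coord_continuous.
  exact: closed_le.
have [|zeta [[zeta1 zeta_le0] clz]] := cS (u @ \oo) _.
  by apply: (@nearW _ \oo) => k; have [] := pP k.
have cl (e M : R) : 0 < e ->
    exists k, [/\ M <= k%:R, k.+1%:R^-1 < e & `|zeta - u k| < e].
  move=> e0.
  have tail : \forall k \near \oo, M <= k%:R /\ k.+1%:R^-1 < e.
    near=> k; split; near: k; first exact: nbhs_infty_ger.
    exact: near_infty_natSinv_lt (PosNum e0).
  have [_ [[k [Mk ke] <-]]] :=
    clz (u @` [set k | M <= k%:R /\ k.+1%:R^-1 < e]) (ball zeta e)
        (filterS (@preimage_image _ _ u _) tail) (nbhsx_ballx _ _ e0).
  by rewrite -ball_normE => zu; exists k.
have zeta0 : zeta = 0.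
  apply: no_normals_at_infinity => //.
    apply: normal_cone_inftyIP => e M e0.
    have [k [Mk _ zu]] := cl e M e0; have [[pk1 _] pk2 _ _ _] := pP k.
    by exists (p k).1.1.1, (u k); split => //; exact: le_trans pk1.
  apply: normal_cone_inftyP => e M e0.
  (* One half bounds the distance from [u k] to [zeta], the other the sum of the two normals, so
     [(p k).2] approaches [- lsubmx zeta]. *)
  have e20 : 0 < e / 2 by rewrite divr_gt0.
  have [k [Mk ke zu]] := cl (e / 2) M e20; have [[_ pk1] _ pk2 _ pk3] := pP k.
  exists (p k).1.2, (p k).2; split => //; first exact: le_trans pk1.
  have -> : - lsubmx zeta - (p k).2 =
      - (lsubmx (zeta - u k) + (lsubmx (u k) + (p k).2)).
    by rewrite linearB/= addrA subrK opprD.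
  rewrite normrN (le_lt_trans (ler_normD _ _))// (splitr e) ltrD//.
    exact: le_lt_trans (norm_lsubmx_le _) zu.
  exact: le_lt_trans pk3 ke.
by move: zeta1; rewrite /= zeta0 normr0 => /esym/eqP; rewrite oner_eq0.
Unshelve. all: by end_near. Qed.

End coercivity.

(** * Tilted problems: lower bounds, compact solution sets, stability *)

Section tilted_minimization.
Context {R : realType} {n : nat}.
Variables (f : 'rV[R]_n -> \bar R) (Omega : set 'rV[R]_n).
Hypotheses (f_proper : forall x, f x != -oo%E) (f_lsc : lower_semicontinuous f).
Hypothesis Omega_closed : closed Omega.

Lemma finite_infP : finite_inf f Omega ->
  (exists m : R, forall x, Omega x -> (m%:E <= f x)%E) /\
  (exists z a, Omega z /\ f z = a%:E).
Proof.
move=> f_inf; split.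
  exists (fine (ereal_inf (f @` Omega))) => x Ox.
  by rewrite fineK//; apply: ereal_inf_lbound; exists x.
(* Without a finite value on [Omega], as also for empty [Omega], the infimum would be [+oo]. *)
apply: contrapT => fO; have : (+oo <= ereal_inf (f @` Omega))%E.
  apply: le_ereal_inf_tmp => _ [x Ox <-]; rewrite leye_eq; apply/eqP.
  move: (f_proper x); case fx : (f x) => [a| |]// _.
  by exfalso; apply: fO; exists x, a.
by rewrite leye_eq => /eqP fO'; move: f_inf; rewrite /finite_inf fO'.
Qed.

Lemma lsc_tilt (u : 'rV[R]_n) : lower_semicontinuous (tilt f u).
Proof.
apply: (lscD_cont _ f (fun x => - dot u x)) => // x.
exact: (cvgN (@cvg_dot _ _ _ (nbhs x) (nbhs_filter x) (cst u) id u x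
  (@cvg_cst _ _ _ _ (nbhs_filter x)) cvg_id)).
Qed.

(** Half of the slope pays for [dot u x] by Cauchy-Schwarz; the constant [c * |rho|] covers the
    points with [enorm x < rho], where only [f >= m] is known. *)
Lemma tilt_growth (m c rho : R) (u : 'rV[R]_n) : 0 < c ->
  (forall x, Omega x -> (m%:E <= f x)%E) ->
  (forall x, Omega x -> rho <= enorm x -> ((m + c * enorm x)%:E <= f x)%E) ->
  enorm u <= c / 2 -> forall x, Omega x ->
  ((m - c * `|rho| + c / 2 * enorm x)%:E <= tilt f u x)%E.
Proof.
move=> c0 fm growth uc x Ox.
have ux : dot u x <= c / 2 * enorm x.
  by rewrite (le_trans (dot_le_enorm _ _))// ler_wpM2r// enorm_ge0.
have x0 := enorm_ge0 x; have rho_le := ler_norm rho.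
have := fm x Ox; have := growth x Ox; rewrite /tilt.
case: (f x) => [a| |]//; last by move=> *; exact: leey.
rewrite -EFinB !lee_fin => xa ma.
have [/xa ?|/ltW ?] := leP rho (enorm x).
  have : 0 <= c * `|rho| by rewrite mulr_ge0// ltW.
  by lra.
have : c * enorm x <= c * `|rho| by rewrite ler_pM2l// (le_trans _ rho_le).
lra.
Qed.

(** The sublevel set of the tilt at its value in [z] is nonempty, closed and bounded by
    [(M - L) / k], so a minimiser on it exists and is global. *)
Lemma Sol_of_growth (L k : R) (u z : 'rV[R]_n) : 0 < k ->
  (forall x, Omega x -> ((L + k * enorm x)%:E <= tilt f u x)%E) ->
  Omega z -> f z \is a fin_num ->
  [/\ finite_inf (tilt f u) Omega, Sol f Omega u !=set0 &
      compact (Sol f Omega u)].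
Proof.
move=> k0 growth Oz /fineK fz; pose M := fine (f z) - dot u z.
have tz : tilt f u z = M%:E by rewrite /tilt -fz -EFinB.
pose K := Omega `&` [set x | (tilt f u x <= M%:E)%E].
have Kz : K z by split => //=; rewrite tz.
have cK : compact K.
  apply: bounded_closed_compact.
    apply: (@bounded_enorm _ _ _ ((M - L) / k)) => x [Ox /= xM].
    rewrite ler_pdivlMr// mulrC lerBrDl -lee_fin.
    exact: le_trans (growth x Ox) xM.
  by apply: closedI => //; apply: lsc_closed_le; exact: lsc_tilt.
split.
- rewrite /finite_inf fin_real//; apply/andP; split.
    apply: (@lt_le_trans _ _ L%:E); first exact: ltNyr.
    apply: le_ereal_inf_tmp => _ [x Ox <-]; apply: le_trans (growth x Ox).
    by rewrite lee_fin lerDl mulr_ge0 ?enorm_ge0 ?ltW.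
  apply: (@le_lt_trans _ _ M%:E); last exact: ltry.
  by rewrite -tz; apply: ereal_inf_lbound; exists z.
- have [|x [Ox xM] x_min] := lsc_compact_min _ K _ (lsc_tilt u) cK.
    by exists z.
  exists x; split => // y Oy; have [yM|/ltW My] := leP (tilt f u y) M%:E.
    exact: x_min.
  exact: le_trans My.
- apply: (subclosed_compact _ cK); last by move=> x [Ox /(_ z Oz)]; rewrite tz.
  (* Optimality is an intersection of closed sublevel conditions, one for each competitor [y]. *)
  rewrite (_ : Sol f Omega u =
    Omega `&` \bigcap_(y in Omega) [set x | (tilt f u x <= tilt f u y)%E]).
    apply: closedI => //; apply: closed_bigI => y Oy.
    by apply: lsc_closed_le; exact: lsc_tilt.
  by apply/seteqP; split => x [].
Qed.

(** For finite [f w], optimality of [y_ k] reads [f (y_ k) <= f w + dot (u k) (y_ k - w)]; the last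
    term vanishes since [u] tends to 0 and [y_] converges, and closed sublevel sets of [f] carry the
    bound to [y]. *)
Lemma Lim_sup0_Sol : Lim_sup0 (Sol f Omega) `<=` Sol f Omega 0.
Proof.
move=> y [u [y_ [u0 y_sol y_y]]]; split.
  apply: (closed_cvg Omega Omega_closed _ y y_y).
  by apply: nearW => k; have [] := y_sol k.
move=> w Ow; rewrite /tilt !dot0l !sube0.
case fw : (f w) (f_proper w) => [b| |]// _; last exact: leey.
apply/lee_addgt0Pr => e e0; rewrite -EFinD.
apply: (closed_cvg _ (lsc_closed_le _ f (b + e)%:E f_lsc) _ y y_y).
have small : dot (u k) (y_ k - w) @[k --> \oo] --> 0.
  rewrite -(dot0l (y - w)); apply: cvg_dot => //.
  by apply: cvgB => //; exact: cvg_cst.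
near=> k => /=; have [Oyk /(_ w Ow)] := y_sol k.
have : dot (u k) (y_ k - w) < e by near: k; apply: (cvgr_lt 0 small).
rewrite /tilt fw dotDr dotNr; case: (f (y_ k)) => [a| |].
- by rewrite -!EFinB !lee_fin; lra.
- by move=> _; rewrite leye_eq.
- by move=> *; exact: leNye.
Unshelve. all: by end_near. Qed.

End tilted_minimization.

Theorem theorem6p5 (R : realType) (n : nat) (f : 'rV[R]_n -> \bar R)
    (Omega : set 'rV[R]_n)
    (f_proper : forall x, f x != -oo%E)
    (f_lsc : lower_semicontinuous f)
    (Omega_closed : closed Omega)
    (A1 : unbounded (dom f `&` Omega))
    (A2 : singular_subdiff_infty f `&`
            [set - v | v in normal_cone_infty Omega] = [set 0])
    (A3 : finite_inf f Omega)
    (h0 : ~ [set v + w | v in subdiff_infty f & w in normal_cone_infty Omega]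
              (0 : 'rV[R]_n)) :
  exists2 e : R, 0 < e &
    forall u : 'rV[R]_n, enorm u <= e ->
      [/\ finite_inf (tilt f u) Omega,
          Sol f Omega u !=set0 /\ compact (Sol f Omega u) &
          Lim_sup0 (Sol f Omega) `<=` Sol f Omega 0].
Proof.
have [[m fm] [z [a [Oz fz]]]] := finite_infP f Omega f_proper A3.
have [c c0 [rho growth]] :=
  linear_growth f Omega f_proper f_lsc Omega_closed A2 h0 m fm.
have c20 : 0 < c / 2 by rewrite divr_gt0.
(* Half of the growth rate may be spent on the tilt; the other half remains as coercivity. *)
exists (c / 2) => // u uc.
have [] := Sol_of_growth f Omega f_proper f_lsc Omega_closed _ _ u z c20
  (tilt_growth f Omega m c rho u c0 fm growth uc) Oz; first by rewrite fz.
by split => //; exact: Lim_sup0_Sol.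
Qed.
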